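(* Let $G=(V,E)$ be an infinite connected graph with all degrees bounded by $\Delta<\infty$, which is non-amenable (i.e. $\kappa_V(G)>0$) and satisfies $\inf_{x\in V}P_x[\tilde H_x=\infty]>0$. Then \[ u_c(G)\ \ge\ \frac{1}{2\Delta^2}\left(\frac{1}{\rho}-1\right). \]
   Context: Setting: $G=(V,E)$ is an infinite, connected, locally finite graph; $d_x$ is the degree of $x$, $d(\cdot,\cdot)$ the graph distance. $P_x$ is the law of simple random walk $(X_n)_{n\ge0}$ on $G$ started at $x$, and $p^{(n)}(x,y)=P_x[X_n=y]$. For $K\subset V$, $\tilde H_K=\inf\{n\ge1: X_n\in K\}$ and $\tilde H_x=\tilde H_{\{x\}}$. The spectral radius is $\rho=\limsup_{n\to\infty}p^{(n)}(x,y)^{1/n}$ (independent of $x,y$). The outer vertex boundary of $K$ is $\partial_VK=\{y\notin K:\exists x\in K,\ d(x,y)=1\}$ and $\kappa_V(G)=\inf\{|\partial_VK|/|K|: 0<|K|<\infty\}$; $G$ is non-amenable if $\kappa_V>0$. Random interlacements (on a graph where simple random walk is transient): for finite $K\subset V$ let $e_K(x)=1_{\{x\in K\}}d_xP_x[\tilde H_K=\infty]$ and $\mathrm{cap}(K)=\sum_xe_K(x)$. Let $W$ be the set of doubly infinite nearest-neighbour paths $w:\mathbb Z\to V$ visiting each vertex finitely often, $W^*$ the quotient of $W$ by time shifts, $\pi^*:W\to W^*$ the projection, and $W^*_K$ the set of classes of paths hitting $K$. There is a unique $\sigma$-finite measure $\nu$ on $W^*$ such that for every finite $K$, $1_{W^*_K}\nu=\pi^*\circ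 Q_K$, where $Q_K[(X_{-n})_{n\ge0}\in A,\,X_0=x,\,(X_n)_{n\ge0}\in B]=P_x[A\mid\tilde H_K=\infty]\,e_K(x)\,P_x[B]$. Under $\mathbb P_u$, $\omega$ is a Poisson point process on $W^*$ with intensity $u\nu$; the interlacement set $\mathcal I$ is the union of the ranges of the trajectories in its support (equivalently $\mathcal I$ is the random subset with $\mathbb P_u[\mathcal I\cap K=\emptyset]=e^{-u\,\mathrm{cap}(K)}$ for all finite $K$). $\mathcal I$ is called connected if the subgraph of $G$ induced by $\mathcal I$ is connected, and $u_c(G)=\inf\{u:\mathcal I\text{ is connected }\mathbb P_u\text{-a.s.}\}$. *)

(* Defs.v *)
From HB Require Import structures.
From mathcomp Require Import all_boot all_order all_algebra.
From mathcomp Require Import all_classical all_reals all_analysis.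
Set Implicit Arguments. Unset Strict Implicit. Unset Printing Implicit Defensive.
Import Order.TTheory GRing.Theory Num.Theory.
Local Open Scope classical_set_scope.
Local Open Scope ring_scope.

Section Graph.
Variables (V : eqType) (nbr : V -> seq V).

Definition adj (x y : V) : bool := y \in nbr x.
Definition deg (x : V) : nat := size (nbr x).

Definition simple_graph : Prop :=
  [/\ forall x, uniq (nbr x), forall x, x \notin nbr x
    & forall x y, (y \in nbr x) = (x \in nbr y)].

Definition infinite_graph : Prop := forall s : seq V, exists x, x \notin s.

Definition connected_graph : Prop :=
  forall x y : V, exists p : seq V, path adj x p /\ last x p = y.

Definition degree_bounded (D : nat) : Prop := forall x, (deg x <= D)%N.

Definition outer_boundary (K : seq V) : seq V :=
  undup [seq y <- flatten (map nbr K) | y \notin K].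

Definition nonamenable (R : realType) : Prop :=
  exists c : R, 0 < c /\ forall K : seq V, K != [::] ->
    c * (size (undup K))%:R <= (size (outer_boundary K))%:R.

Variable R : realType.

Fixpoint pstep (n : nat) (x y : V) : R :=
  match n with
  | 0%N => (x == y)%:R
  | n'.+1 => \sum_(z <- nbr x) (deg x)%:R^-1 * pstep n' z y
  end.

(* spectral radius rho = limsup_n p^(n)(x,y)^(1/n) (finite, in [0,1]) *)
Definition spectral_radius (x y : V) : R :=
  fine (limn_esup (fun n => ((pstep n x y) `^ (n%:R^-1))%:E)).

(* P_x[ X_m \notin K for all 1 <= m <= n ] *)
Fixpoint avoid (K : seq V) (n : nat) (x : V) : R :=
  match n with
  | 0%N => 1
  | n'.+1 => \sum_(z <- nbr x) (deg x)%:R^-1 * ((z \notin K)%:R * avoid K n' z)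
  end.

(* P_x[ tilde H_K = infinity ] : the limit (= infimum) of the decreasing
   sequence avoid K n x *)
Definition escape (K : seq V) (x : V) : R := inf (range (fun n => avoid K n x)).

Definition eq_measure (K : seq V) (x : V) : R :=
  (x \in K)%:R * (deg x)%:R * escape K x.
Definition cap (K : seq V) : R := \sum_(x <- undup K) eq_measure K x.

Definition unif_escape : Prop :=
  exists c : R, 0 < c /\ forall x, c <= escape [:: x] x.

Definition cyl : set (set (set V)) :=
  [set [set A : set V | A x] | x in [set: V]].
Definition config := g_sigma_algebraType cyl.

Definition interlacement_law (u : R) (mu : probability config R) : Prop :=
  forall K : seq V,
    mu [set A : config | forall x, x \in K -> ~ A x] = (expR (- (u * cap K)))%:E.

Definition induced_connected (A : set V) : Prop :=
  forall x y, A x -> A y ->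
    exists p : seq V, [/\ path adj x p, all (fun z => `[< A z >]) p & last x p = y].

Definition u_crit : \bar R :=
  ereal_inf [set u%:E | u in [set u : R | 0 < u /\
     forall mu : probability config R, interlacement_law u mu ->
       mu [set A : config | induced_connected A] = 1%E]].

End Graph.

(* Main.v *)
(* Random interlacements are a limit of finite Poissonian soups of random walk
   paths: a path of length [L] started from the stationary measure [deg], with
   total intensity divided by [L + 1], hits [K] with a mass which is the Cesaro
   mean of the truncated capacities of [K] (decompose at the last visit).  The
   soups converge to a finitely additive law on vertex sets, which is countably
   additive on a countable product of two-point spaces; this is the interlacement
   law.

   In a soup, vertices [x] and [y] of the same cluster are joined by a chain of
   distinct paths, consecutive ones containing adjacent vertices.  Since a path
   through two points [x], [z] has mass at most [2 deg x g(x, z)], the union bound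
   over chains is dominated by a walk branching with mean [s = 1 + 2 u D^2]:
   P[x <-> y] <= 2 u D sum_n s^n p^(n)(x, y).  By reversibility
   p^(n)(x, y) <= D r^n for every [r > rho], so if [s rho < 1] this tends to 0 as
   [y] moves away from [x], whereas the probability that [x] and [y] are both
   occupied stays bounded below; hence the interlacement set is not a.s.
   connected. *)
Require Import Defs.
From HB Require Import structures.
From mathcomp Require Import all_boot all_order all_algebra.
From mathcomp Require Import all_classical all_reals all_analysis.
From mathcomp Require Import ring lra zify.
Set Implicit Arguments. Unset Strict Implicit. Unset Printing Implicit Defensive.
Import Order.TTheory GRing.Theory Num.Theory.
Import numFieldNormedType.Exports.
Local Open Scope classical_set_scope.
Local Open Scope ring_scope.

(** * Simple random walk *)

Section Walk.
Variables (R : realType) (V : eqType) (nbr : V -> seq V) (D : nat).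
Hypotheses (sg : simple_graph nbr) (dpos : forall x, (0 < deg nbr x)%N)
  (degD : degree_bounded nbr D).

Local Notation p := (pstep nbr R).
Local Notation dg x := ((deg nbr x)%:R : R).

Let uniq_nbr x : uniq (nbr x). Proof. by case: sg. Qed.

Let nbr_sym x y : (y \in nbr x) = (x \in nbr y). Proof. by case: sg. Qed.

Let dg_gt0 x : 0 < dg x. Proof. by rewrite ltr0n. Qed.

Let dg_neq0 x : dg x != 0. Proof. by rewrite gt_eqF. Qed.

Let dg_leD x : dg x <= D%:R. Proof. by rewrite ler_nat. Qed.

Lemma sum_inv_deg x : \sum_(z <- nbr x) (dg x)^-1 = 1.
Proof.
rewrite big_const_seq count_predT iter_addr_0.
by rewrite -[LHS]mulr_natl; exact: (mulfV (dg_neq0 x)).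
Qed.

Lemma pstep_ge0 n x y : 0 <= p n x y.
Proof.
elim: n x => [|n IH] x /=; first by rewrite ler0n.
by apply: sumr_ge0 => z _; rewrite mulr_ge0 ?invr_ge0.
Qed.

Lemma sum_delta (T : eqType) (s : seq T) (a : T) (f : T -> R) : uniq s ->
  \sum_(z <- s) (z == a)%:R * f z = (a \in s)%:R * f a.
Proof.
move=> us; have [ain|anin] := boolP (a \in s).
  rewrite (bigD1_seq a) //= eqxx big1 ?addr0 // => z /negPf ->.
  by rewrite mul0r.
rewrite mul0r big_seq big1 // => z zs.
by case: eqP => [za|]; rewrite ?mul0r //; rewrite za (negPf anin) in zs.
Qed.

Lemma sum_delta1 (T : eqType) (s : seq T) (a : T) : uniq s ->
  \sum_(z <- s) (a == z)%:R = (a \in s)%:R :> R.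
Proof.
move=> /(sum_delta a (fun=> 1)); rewrite mulr1 => <-.
by apply: eq_bigr => z _; rewrite mulr1 eq_sym.
Qed.

(* The definition of [pstep] conditions on the first step; this one conditions
   on the last. *)
Lemma pstep_last n x y :
  p n.+1 x y = \sum_(z <- nbr y) (dg z)^-1 * p n x z.
Proof.
elim: n x y => [|n IH] x y.
  rewrite /=.
  under eq_bigr do rewrite mulrC.
  rewrite sum_delta //.
  under [in RHS]eq_bigr do rewrite mulrC eq_sym.
  by rewrite sum_delta // nbr_sym.
transitivity (\sum_(z <- nbr x) (dg x)^-1 * p n.+1 z y) => //.
under eq_bigr do rewrite IH mulr_sumr.
rewrite exchange_big /=; apply: eq_bigr => z _.
by rewrite mulr_sumr; apply: eq_bigr => w _; rewrite mulrCA.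
Qed.

(** Reversibility with respect to [deg]: the last-step expansion of one side matches the first-step
    expansion of the other term by term. *)
Lemma pstep_rev n x y : dg x * p n x y = dg y * p n y x.
Proof.
elim: n x y => [|n IH] x y.
  by rewrite /= eq_sym; case: eqP => [->|]; rewrite ?mulr0.
rewrite pstep_last /= !mulr_sumr; apply: eq_bigr => z _.
have := IH x z; have := dg_neq0 y; have := dg_neq0 z => hz hy e.
rewrite mulrA [dg y * _]mulrA divff // mul1r.
apply: (mulfI hz); rewrite -e; field.
exact: hz.
Qed.

Lemma pstep_revE n x y : p n y x = dg x / dg y * p n x y.
Proof. by rewrite mulrAC pstep_rev mulrC mulKf. Qed.

Lemma pstep_mul_le m n x y z : p m x z * p n z y <= p (m + n)%N x y.
Proof.
elim: m x => [|m IH] x /=.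
  by case: eqP => [->|_]; rewrite ?mul1r ?mul0r ?pstep_ge0.
rewrite mulr_suml; apply: ler_sum => w _.
by rewrite -mulrA ler_wpM2l ?invr_ge0.
Qed.

Lemma pstep_expr_le n k x : p n x x ^+ k <= p (n * k)%N x x.
Proof.
elim: k => [|k IH]; first by rewrite muln0 /= eqxx.
rewrite exprS mulnS; apply: le_trans (pstep_mul_le n (n * k) x x x).
by rewrite ler_wpM2l ?pstep_ge0.
Qed.

(* Reversibility turns a lower bound for the return probability into an upper
   bound for [p n x y]: [p n x y ^+ 2 <= D * p n x y * p n y x]. *)
Lemma pstep_sqr_le n x y : p n x y ^+ 2 <= D%:R * p (n + n)%N x x.
Proof.
apply: le_trans (_ : D%:R * (p n x y * p n y x) <= _); last first.
  by apply: ler_wpM2l; [exact: ler0n|exact: pstep_mul_le].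
rewrite (pstep_revE n x y).
set A := p n x y; set c := D%:R.
have -> : c * (A * (dg x / dg y * A)) = A * (c * dg x / dg y * A) by ring.
rewrite expr2 ler_wpM2l ?pstep_ge0 // ler_peMl ?pstep_ge0 //.
rewrite ler_pdivlMr // mul1r; apply: le_trans (dg_leD y) _.
by rewrite ler_peMr ?ler0n ?ler1n ?dpos.
Qed.

Lemma pstep_path x s : path (adj nbr) x s -> 0 < p (size s) x (last x s).
Proof.
elim: s x => [|z s IH] x /=; first by rewrite eqxx ltr01.
move=> /andP[xz /IH h]; rewrite (big_rem z) //=.
rewrite ltr_wpDr ?mulr_gt0 ?invr_gt0 //.
by apply: sumr_ge0 => w _; rewrite mulr_ge0 ?invr_ge0 ?pstep_ge0.
Qed.

(** Ball of radius [n], listed with repetitions; outside it the walk has mass zero up to time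
    [n]. *)
Fixpoint gball n x : seq V :=
  if n is n'.+1 then x :: flatten [seq gball n' z | z <- nbr x] else [:: x].

Lemma gball_center n x : x \in gball n x.
Proof. by case: n => [|n] /=; rewrite inE ?eqxx. Qed.

Lemma gballS n x : {subset gball n x <= gball n.+1 x}.
Proof.
elim: n x => [|n IH] x y; first by rewrite !inE => /eqP->; rewrite eqxx.
rewrite inE => /predU1P[->|]; first exact: gball_center.
move=> /flattenP[s /mapP[z zx ->] ys]; rewrite inE; apply/orP; right.
by apply/flattenP; exists (gball n.+1 z); [exact: map_f|exact: IH].
Qed.

Lemma gball_mono m n x : (m <= n)%N -> {subset gball m x <= gball n x}.
Proof.
by move=> /subnK <-; elim: (n - m)%N => [//|k IH] y /IH; exact: gballS.
Qed.

Lemma pstep_gball n x y : y \notin gball n x -> p n x y = 0.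
Proof.
elim: n x => [|n IH] x /=.
  by rewrite inE eq_sym => /negPf ->.
rewrite inE negb_or => /andP[_ h]; rewrite big_seq big1 // => z zx.
rewrite IH ?mulr0 //; apply: contra h => h.
by apply/flattenP; exists (gball n z) => //; exact: map_f.
Qed.

Lemma pstep_sum_le n x S : uniq S -> \sum_(a <- S) p n x a <= 1.
Proof.
move=> uS; elim: n x => [|n IH] x /=.
  by rewrite sum_delta1 // lern1 leq_b1.
rewrite exchange_big /=.
apply: (@le_trans _ _ (\sum_(z <- nbr x) (dg x)^-1)).
  by apply: ler_sum => z _; rewrite -mulr_sumr ler_piMr ?invr_ge0.
by rewrite sum_inv_deg.
Qed.

Lemma pstep_sum n x S : uniq S -> {subset gball n x <= S} ->
  \sum_(a <- S) p n x a = 1.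
Proof.
move=> uS; elim: n x => [|n IH] x hS /=.
  by rewrite sum_delta1 // hS ?inE.
rewrite exchange_big /= big_seq.
rewrite (eq_bigr (fun=> (dg x)^-1)) => [|z zx].
  rewrite -big_seq.
  by rewrite sum_inv_deg.
rewrite -mulr_sumr IH ?mulr1 // => y yz; apply: hS; rewrite inE.
by apply/orP; right; apply/flattenP; exists (gball n z) => //; exact: map_f.
Qed.

Lemma avoid_ge0 K n x : 0 <= avoid nbr R K n x.
Proof.
elim: n x => [|n IH] x //=.
by apply: sumr_ge0 => z _; rewrite !mulr_ge0 ?invr_ge0 ?ler0n.
Qed.

Lemma avoid_le1 K n x : avoid nbr R K n x <= 1.
Proof.
elim: n x => [|n IH] x //.
apply: (@le_trans _ _ (\sum_(z <- nbr x) (dg x)^-1)) => /=.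
  apply: ler_sum => z _; rewrite ler_piMr ?invr_ge0 //.
  by rewrite mulr_ile1 ?avoid_ge0 ?lern1 ?leq_b1.
by rewrite sum_inv_deg.
Qed.

Lemma avoid_noninc K n x : avoid nbr R K n.+1 x <= avoid nbr R K n x.
Proof.
elim: n x => [|n IH] x; first exact: avoid_le1.
apply: ler_sum => z _.
apply: ler_wpM2l; first by rewrite invr_ge0.
by apply: ler_wpM2l; [exact: ler0n|exact: IH].
Qed.

Lemma avoid_cvg K x : avoid nbr R K n x @[n --> \oo] --> escape nbr R K x.
Proof.
apply: nonincreasing_cvgn.
  by apply/nonincreasing_seqP => n; exact: avoid_noninc.
by exists 0 => _ [n _ <-]; exact: avoid_ge0.
Qed.

Lemma cvg_sum_seq (T : eqType) (r : seq T) (F : set_system nat)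
    (f : T -> nat -> R) (l : T -> R) : Filter F ->
  (forall i, i \in r -> f i n @[n --> F] --> l i) ->
  \sum_(i <- r) f i n @[n --> F] --> \sum_(i <- r) l i.
Proof.
move=> FF; elim: r => [|i r IH] h.
  by rewrite big_nil; under eq_fun do rewrite big_nil; exact: cvg_cst.
rewrite big_cons; under eq_fun do rewrite big_cons.
apply: cvgD; first by apply: h; rewrite inE eqxx.
by apply: IH => j jr; apply: h; rewrite inE jr orbT.
Qed.

(** Capacity with [escape] replaced by avoidance of [K] for [j] steps, averaged over [j <= L]; in
    the soup, [j] is the time left after the last visit to [K]. *)
Definition cesaro_cap (L : nat) (K : seq V) : R :=
  \sum_(x <- undup K) dg x * (L.+1%:R^-1 * \sum_(j < L.+1) avoid nbr R K j x).

Lemma cesaro_cap_cvg K : cesaro_cap L K @[L --> \oo] --> cap nbr R K.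
Proof.
apply: (@cvg_trans _ ((fun L => \sum_(x <- undup K) (dg x *
   arithmetic_mean (fun n => avoid nbr R K n x) L)) @ \oo)).
  apply: near_eq_cvg; near=> L; apply: eq_bigr => x _.
  by rewrite /arithmetic_mean seriesEord.
apply: cvg_sum_seq => x; rewrite mem_undup => xK; rewrite /Defs.eq_measure xK mul1r.
apply: cvgM; first exact: cvg_cst.
exact/cesaro/avoid_cvg.
Unshelve. all: by end_near.
Qed.

Definition avg (h : V -> R) (x : V) : R := \sum_(z <- nbr x) (dg x)^-1 * h z.

Definition green L x z : R := \sum_(m < L.+1) p m x z.

Lemma green_ge0 L x z : 0 <= green L x z.
Proof. by apply: sumr_ge0 => i _; exact: pstep_ge0. Qed.

Lemma greenS L x z : green L.+1 x z = (x == z)%:R + avg (green L ^~ z) x.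
Proof.
rewrite /green big_ord_recl /=; congr (_ + _).
rewrite exchange_big /=; apply: eq_bigr => w _.
by rewrite mulr_sumr.
Qed.

(** Expected number of particles at [y] in the first [N] generations of a walk from [x] branching
    with mean [s]. *)
Definition gen_fun (s : R) N x y : R := \sum_(m < N) s ^+ m * p m x y.

Lemma gen_funS s N x y :
  gen_fun s N.+1 x y = (x == y)%:R + s * avg (gen_fun s N ^~ y) x.
Proof.
rewrite /gen_fun big_ord_recl /= expr0 mul1r; congr (_ + _).
under eq_bigr do rewrite /bump /= exprS -mulrA mulr_sumr.
rewrite -mulr_sumr exchange_big /=; congr (_ * _).
apply: eq_bigr => z _; rewrite mulr_sumr.
by apply: eq_bigr => i _; rewrite mulrCA.
Qed.

Lemma avg_ge0 h x : (forall z, 0 <= h z) -> 0 <= avg h x.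
Proof. by move=> h0; apply: sumr_ge0 => z _; rewrite mulr_ge0 ?invr_ge0. Qed.

Lemma avg_le h k x : (forall z, h z <= k z) -> avg h x <= avg k x.
Proof. by move=> hk; apply: ler_sum => z _; rewrite ler_wpM2l ?invr_ge0. Qed.

Lemma gen_fun_ge0 s N x y : 0 <= s -> 0 <= gen_fun s N x y.
Proof.
by move=> s0; apply: sumr_ge0 => m _; rewrite mulr_ge0 ?exprn_ge0 ?pstep_ge0.
Qed.

Lemma gen_fun_leS s N x y : 0 <= s -> gen_fun s N x y <= gen_fun s N.+1 x y.
Proof.
move=> s0; rewrite /gen_fun big_ord_recr /= lerDl.
by rewrite mulr_ge0 ?exprn_ge0 ?pstep_ge0.
Qed.

Lemma gen_fun_le_mono s N M x y : 0 <= s -> (N <= M)%N ->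
  gen_fun s N x y <= gen_fun s M x y.
Proof.
move=> s0 /subnK <-; elim: (M - N)%N => [//|k IH].
by apply: le_trans IH _; exact: gen_fun_leS.
Qed.

Lemma green_sumS L x Z (h : V -> R) :
  \sum_(z <- Z) green L.+1 x z * h z =
  \sum_(z <- Z) (x == z)%:R * h z + avg (fun w => \sum_(z <- Z) green L w z * h z) x.
Proof.
under eq_bigr do rewrite greenS mulrDl.
rewrite big_split /=; congr (_ + _); rewrite /avg.
under eq_bigr do rewrite mulr_suml.
rewrite exchange_big /=; apply: eq_bigr => w _; rewrite mulr_sumr.
by apply: eq_bigr => z _; rewrite mulrA.
Qed.

(* A walk that may branch at rate [eps] per step has [s = 1 + eps] expected
   children per step; the right-hand side counts its particles. *)
Lemma green_gen_fun (eps : R) L N x y (Z : seq V) : 0 <= eps -> uniq Z ->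
  \sum_(z <- Z) green L x z *
    ((z == y)%:R + eps * avg (gen_fun (1 + eps) N ^~ y) z) <=
  gen_fun (1 + eps) (N + L.+1)%N x y.
Proof.
move=> eps0 uZ; have s0 : 0 <= 1 + eps by rewrite addr_ge0.
pose h z := (z == y)%:R + eps * avg (gen_fun (1 + eps) N ^~ y) z.
rewrite -[X in X <= _]/(\sum_(z <- Z) green L x z * h z).
have h0 z : 0 <= h z.
  by rewrite addr_ge0 ?mulr_ge0 ?avg_ge0 // => w; exact: gen_fun_ge0.
have dle w : \sum_(z <- Z) (w == z)%:R * h z <= h w.
  rewrite (eq_bigr (fun z => (z == w)%:R * h z)) => [|z _]; last by rewrite eq_sym.
  by rewrite sum_delta // ler_piMl ?lern1 ?leq_b1.
elim: L x => [|L IH] x.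
  under eq_bigr do rewrite /green big_ord1 /=.
  apply: le_trans (dle x) _; rewrite addn1 gen_funS lerD2l mulrDl mul1r lerDr.
  by apply: avg_ge0 => w; exact: gen_fun_ge0.
rewrite green_sumS addnS gen_funS.
apply: (@le_trans _ _ (h x + avg (gen_fun (1 + eps) (N + L.+1) ^~ y) x)).
  by apply: lerD; [exact: dle|exact: avg_le].
(* The offspring branched off at [x] runs for [N] generations only; extending it to [N + L.+1]
   merges it with the main walk into the factor [1 + eps]. *)
rewrite /h -addrA lerD2l mulrDl mul1r addrC lerD2l ler_wpM2l //.
by apply: avg_le => w; apply: gen_fun_le_mono => //; rewrite leq_addr.
Qed.

End Walk.

(** * The spectral radius *)

Section Spectral.
Variables (R : realType) (V : eqType) (nbr : V -> seq V) (D : nat).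
Hypotheses (sg : simple_graph nbr) (dpos : forall x, (0 < deg nbr x)%N)
  (degD : degree_bounded nbr D).
Hypothesis (cg : connected_graph nbr).

Local Notation p := (pstep nbr R).

(** By Bernoulli's inequality the powers of some [t > 1] grow at least linearly. *)
Lemma expr_bounded_le1 (t C : R) (K : nat) :
  (forall k, (K <= k)%N -> t ^+ k <= C) -> t <= 1.
Proof.
move=> h; rewrite leNgt; apply/negP => t1.
have bern k : 1 + k%:R * (t - 1) <= t ^+ k.
  elim: k => [|k IH]; first by rewrite mul0r addr0.
  rewrite exprS; apply: (@le_trans _ _ (t * (1 + k%:R * (t - 1)))).
    have : 0 <= k%:R * ((t - 1) * (t - 1)) by rewrite mulr_ge0 ?ler0n ?sqr_ge0.
    by rewrite -natr1; lra.
  by rewrite ler_wpM2l // ltW // (lt_trans ltr01).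
have t0 : 0 < t - 1 by rewrite subr_gt0.
set k := maxn K (Num.truncn (C / (t - 1))).+1.
have kb : C / (t - 1) < k%:R.
  apply: lt_le_trans (truncnS_gt _) _.
  by rewrite ler_nat leq_max leqnn orbT.
have := le_trans (bern k) (h k (leq_maxl _ _)).
rewrite ltr_pdivrMr // in kb => hb.
have := le_lt_trans hb kb; rewrite -subr_gt0.
by rewrite opprD addrA addrAC subrr sub0r oppr_gt0 ltr10.
Qed.

Lemma spectral_radius_eventually x y (r : R) :
  0 < spectral_radius nbr R x y -> spectral_radius nbr R x y < r ->
  exists N, forall m, (N <= m)%N -> p m x y <= r ^+ m.
Proof.
rewrite /spectral_radius; set u := fun n => _.
move=> rho0 rhor.
have : (limn_esup u < r%:E)%E.
  (* An infinite limsup would be sent to [0] by [fine]; positivity of the radius excludes it. *)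
  by move: rho0 rhor; case: (limn_esup u) => [s| |] //=; rewrite ?ltxx // lte_fin.
have -> : limn_esup u = ereal_inf (range (esups u)).
  by rewrite limn_esup_lim; apply/cvg_lim => //; exact: cvg_esups_inf.
move=> /ereal_inf_lt[_ [N _ <-] hN].
have r0 : 0 < r by exact: lt_trans rhor.
(* The successor keeps [m] positive, so that the [m]-th root can be undone. *)
exists N.+1 => m Nm.
have : (u m <= esups u N)%E.
  by apply: ereal_sup_ubound; exists m => //=; exact: ltnW.
move=> /le_lt_trans/(_ hN); rewrite lte_fin => hm.
have m0 : m%:R != 0 :> R by rewrite pnatr_eq0 -lt0n (leq_trans _ Nm).
have -> : p m x y = (p m x y `^ m%:R^-1) ^+ m.
  by rewrite -powR_mulrn ?powR_ge0 // -powRrM mulVf // powRr1 // pstep_ge0.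
by rewrite lerXn2r ?nnegrE ?powR_ge0 ?(ltW hm) ?(ltW r0).
Qed.

(** Join [x] to [z] and [z] to [y] by fixed paths and insert [k] loops of length [n] at [z]: the
    power [(p n z z / r ^+ n) ^+ k] stays bounded as [k] grows, so the ratio is at most 1. The bound
    thus carries no constant and is uniform in [z]. *)
Lemma pstep_return_le x y (r : R) z n :
  0 < spectral_radius nbr R x y -> spectral_radius nbr R x y < r ->
  p n z z <= r ^+ n.
Proof.
move=> rho0 rhor; have r0 : 0 < r by exact: lt_trans rhor.
case: n => [|n]; first by rewrite /= eqxx expr0.
have [N hN] := spectral_radius_eventually rho0 rhor.
have [s [/(pstep_path R dpos) + sz]] := cg x z; rewrite sz.
move: (size s) => a pa.
have [s' [/(pstep_path R dpos) + sy]] := cg z y; rewrite sy.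
move: (size s') => b pb.
rewrite -[X in _ <= X]mul1r -ler_pdivrMr ?exprn_gt0 //.
apply: (@expr_bounded_le1 _ (r ^+ (a + b) / (p a x z * p b z y)) N) => k Nk.
rewrite ler_pdivlMr ?mulr_gt0 // expr_div_n mulrAC ler_pdivrMr ?exprn_gt0 //.
apply: (@le_trans _ _ (p (a + (n.+1 * k + b))%N x y)).
  apply: le_trans _ (pstep_mul_le _ _ _ _ _ _ z).
  rewrite mulrCA; apply: ler_wpM2l; first exact: pstep_ge0.
  apply: le_trans _ (pstep_mul_le _ _ _ _ _ _ z).
  by apply: ler_wpM2r; [exact: pstep_ge0|exact: pstep_expr_le].
rewrite -exprM -exprD [X in _ <= r ^+ X]addnAC -addnA.
by apply: hN; nia.
Qed.

Lemma pstep_le_expr x y (r : R) a b n :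
  0 < spectral_radius nbr R x y -> spectral_radius nbr R x y < r ->
  p n a b <= D%:R * r ^+ n.
Proof.
move=> rho0 rhor; have r0 : 0 < r by exact: lt_trans rhor.
have D1 : 1 <= D%:R :> R.
  by rewrite ler1n (leq_trans (dpos a)).
(* Compare squares: [pstep_sqr_le] reduces to a return probability at time [2n], and
   [D <= D ^+ 2]. *)
rewrite -(@ler_pXn2r _ 2) ?nnegrE ?pstep_ge0 ?mulr_ge0 ?exprn_ge0 ?(ltW r0) //.
apply: le_trans (pstep_sqr_le R sg dpos degD n a b) _.
rewrite exprMn -exprM muln2 -addnn.
apply: ler_pM => //; rewrite ?pstep_ge0 //.
  by rewrite expr2 ler_peMl.
exact: pstep_return_le rho0 rhor.
Qed.

End Spectral.

(** * Finite path soups *)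

Section Soup.
Variables (R : realType) (V : eqType) (nbr : V -> seq V).
Hypotheses (sg : simple_graph nbr) (dpos : forall x, (0 < deg nbr x)%N).

Local Notation p := (pstep nbr R).
Local Notation dg x := ((deg nbr x)%:R : R).
Local Notation avg := (@avg R V nbr).
Local Notation green := (green R nbr).

Let dg_ge0 x : 0 <= (dg x)^-1. Proof. by rewrite invr_ge0. Qed.

(* Paths [X_0, ..., X_L] of the walk from [a], paired with their probability. *)
Fixpoint walks L a : seq (R * seq V) :=
  if L is L'.+1 then
    [seq ((dg a)^-1 * i.1, a :: i.2) | z <- nbr a, i <- walks L' z]
  else [:: (1, [:: a])].

Definition expect (s : seq (R * seq V)) (f : seq V -> R) : R :=
  \sum_(i <- s) i.1 * f i.2.

Lemma expect_walks0 a f : expect (walks 0 a) f = f [:: a].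
Proof. by rewrite /expect /= big_seq1 mul1r. Qed.

Lemma expect_walksS L a f :
  expect (walks L.+1 a) f = avg (fun z => expect (walks L z) (f \o cons a)) a.
Proof.
rewrite /expect big_allpairs_dep /=; apply: eq_bigr => z _.
by rewrite mulr_sumr; apply: eq_bigr => i _; rewrite mulrA.
Qed.

Lemma walks_ge0 L a i : i \in walks L a -> 0 <= i.1.
Proof.
elim: L a i => [|L IH] a i /=; first by rewrite inE => /eqP ->.
by move=> /allpairsPdep[z [j [_ /IH j0 ->]]] /=; rewrite mulr_ge0.
Qed.

Lemma expectD s f g : expect s (fun c => f c + g c) = expect s f + expect s g.
Proof. by rewrite /expect -big_split /=; apply: eq_bigr => i _; rewrite mulrDr. Qed.

Lemma expectZ s k f : expect s (fun c => k * f c) = k * expect s f.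
Proof. by rewrite /expect mulr_sumr; apply: eq_bigr => i _; rewrite mulrCA. Qed.

Lemma expect_le s f g : {in s, forall i, 0 <= i.1} ->
  (forall c, f c <= g c) -> expect s f <= expect s g.
Proof.
move=> s0 fg; rewrite /expect big_seq [leRHS]big_seq.
by apply: ler_sum => i /s0 i0; exact: ler_wpM2l.
Qed.

Let avgD h k x : avg (fun z => h z + k z) x = avg h x + avg k x.
Proof. by rewrite /avg -big_split /=; apply: eq_bigr => i _; rewrite mulrDr. Qed.

Let avgZ c h x : avg (fun z => c * h z) x = c * avg h x.
Proof. by rewrite /avg mulr_sumr; apply: eq_bigr => i _; rewrite mulrCA. Qed.

Let avg1 x : avg (fun=> 1) x = 1.
Proof.
rewrite /avg; under eq_bigr do rewrite mulr1.
exact: sum_inv_deg.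
Qed.

Let eq_avg h k x : (forall z, h z = k z) -> avg h x = avg k x.
Proof. by move=> hk; apply: eq_bigr => z _; rewrite hk. Qed.

Lemma expect_walks1 L a : expect (walks L a) (fun=> 1) = 1.
Proof.
elim: L a => [|L IH] a; first exact: expect_walks0.
by rewrite expect_walksS (eq_avg _ IH) avg1.
Qed.

(** The probability of a visit is at most the expected number of visits. *)
Lemma expect_mem L a z : expect (walks L a) (fun c => (z \in c)%:R) <= green L a z.
Proof.
elim: L a => [|L IH] a.
  by rewrite expect_walks0 /green big_ord1 /= inE eq_sym.
rewrite expect_walksS greenS.
apply: (@le_trans _ _ (avg (fun w => (a == z)%:R * 1 +
    expect (walks L w) (fun c => (z \in c)%:R)) a)).
  apply: avg_le => w; rewrite -[X in _ * X](expect_walks1 L w) -expectZ -expectD.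
  apply: expect_le => [i|c /=]; first exact: walks_ge0.
  by rewrite inE [z == a]eq_sym; case: (a == z); case: (z \in c); rewrite /=; lra.
rewrite avgD avgZ avg1 mulr1 lerD2l.
by apply: avg_le => w; exact: IH.
Qed.

(* Number of times [i] with [c_i = x] after which [z] is still visited. *)
Fixpoint npairs x z (c : seq V) : R :=
  if c is a :: c' then (a == x)%:R * (z \in c)%:R + npairs x z c' else 0.

Lemma npairs_ge0 x z c : 0 <= npairs x z c.
Proof. by elim: c => //= a c IH; rewrite addr_ge0 ?mulr_ge0 ?ler0n. Qed.

(** If both points are visited, one of them is seen at or after a visit to the other. *)
Lemma mem_npairs x z c :
  ((x \in c) && (z \in c))%:R <= npairs x z c + npairs z x c.
Proof.
elim: c => [|a c IH] /=; first by rewrite addr0.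
have hx := npairs_ge0 x z c; have hz := npairs_ge0 z x c.
rewrite !inE !(eq_sym a); move: IH.
by case: (x == a); case: (z == a); case: (x \in c); case: (z \in c) => /=;
  rewrite ?mulr1 ?mul0r ?mulr0; lra.
Qed.

Lemma green_leS L x z : green L x z <= green L.+1 x z.
Proof. by rewrite /green [leRHS]big_ord_recr lerDl pstep_ge0. Qed.

(** Markov property at each visit to [x]: from there [z] is reached with probability at most
    [green L x z]. The sum over visit times stays explicit so that it can be reversed in
    [soup_pair]. *)
Lemma expect_npairs L a x z :
  expect (walks L a) (npairs x z) <= (\sum_(i < L.+1) p i a x) * green L x z.
Proof.
elim: L a => [|L IH] a.
  rewrite expect_walks0 /green !big_ord1 /= addr0 inE.
  by rewrite [z == a]eq_sym; case: (eqVneq a x) => [->|]; rewrite ?mul0r.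
have -> : expect (walks L.+1 a) (npairs x z) =
    (a == x)%:R * expect (walks L.+1 a) (fun c => (z \in c)%:R) +
    avg (fun w => expect (walks L w) (npairs x z)) a.
  rewrite !expect_walksS -avgZ -avgD; apply: eq_avg => w.
  by rewrite -expectZ -expectD.
rewrite -/(green L.+1 a x) greenS mulrDl; apply: lerD.
  by case: eqP => [->|]; rewrite ?mul0r // !mul1r expect_mem.
apply: (@le_trans _ _ (avg (fun w => green L x z * green L w x) a)).
  by apply: avg_le => w; rewrite mulrC; exact: IH.
rewrite avgZ mulrC ler_wpM2l ?green_leS //.
by apply: avg_ge0 => w; exact: green_ge0.
Qed.

(** [avoid] looks at [K] from time 1 on only, hence the separate factor for the starting point. *)
Lemma expect_avoid K L a :
  expect (walks L a) (fun c => (~~ has (mem K) c)%:R) =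
  (a \notin K)%:R * avoid nbr R K L a.
Proof.
elim: L a => [|L IH] a; first by rewrite expect_walks0 /= orbF mulr1.
rewrite expect_walksS /=.
rewrite -[X in _ = _ * X]/(avg (fun z => (z \notin K)%:R * avoid nbr R K L z) a).
rewrite -avgZ; apply: eq_avg => z; rewrite -IH -expectZ.
by apply: eq_bigr => i _; rewrite /= negb_or -natrM mulnb.
Qed.

(* Decomposition of the hitting event at the last visit to [K]. *)
Lemma expect_hit K L a :
  expect (walks L a) (fun c => (has (mem K) c)%:R) =
  \sum_(x <- undup K) \sum_(i < L.+1) p i a x * avoid nbr R K (L - i) x.
Proof.
have hit_avoid M b : expect (walks M b) (fun c => (has (mem K) c)%:R) =
    1 - (b \notin K)%:R * avoid nbr R K M b.
  rewrite -expect_avoid -[X in X - _](expect_walks1 M b); apply/eqP.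
  rewrite eq_sym subr_eq -expectD; apply/eqP/eq_bigr => i _.
  by case: (has _ _); rewrite /= ?addr0 ?add0r.
elim: L a => [|L IH] a.
  rewrite hit_avoid /= mulr1.
  under eq_bigr do rewrite big_ord1 /= mulr1.
  rewrite sum_delta1 ?undup_uniq // mem_undup.
  by case: (a \in K); rewrite ?subr0 ?subrr.
(* Split off [i = 0], where the last visit is at the start; the other terms are the same
   decomposition one step later. *)
rewrite (eq_bigr (fun x => (a == x)%:R * avoid nbr R K L.+1 x +
  \sum_(i < L.+1) p i.+1 a x * avoid nbr R K (L - i) x)); last first.
  by move=> x _; rewrite big_ord_recl.
rewrite big_split.
rewrite (eq_bigr (fun x => (x == a)%:R * avoid nbr R K L.+1 x)); last first.
  by move=> x _; rewrite eq_sym.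
rewrite sum_delta ?undup_uniq // mem_undup.
have -> : \sum_(x <- undup K) \sum_(i < L.+1) p i.+1 a x *
    avoid nbr R K (L - i) x =
    avg (fun w => expect (walks L w) (fun c => (has (mem K) c)%:R)) a.
  rewrite (eq_avg _ IH) /avg.
  under [RHS]eq_bigr do rewrite mulr_sumr.
  rewrite [RHS]exchange_big /=; apply: eq_bigr => x _.
  under [RHS]eq_bigr do rewrite mulr_sumr.
  rewrite [RHS]exchange_big /=; apply: eq_bigr => i _.
  rewrite mulr_suml; apply: eq_bigr => w _.
  by rewrite mulrA.
rewrite (eq_avg _ (hit_avoid L)) hit_avoid.
have -> : avg (fun z => 1 - (z \notin K)%:R * avoid nbr R K L z) a =
    1 - avoid nbr R K L.+1 a.
  rewrite -[in RHS](avg1 a) /avg /= -sumrB; apply: eq_bigr => z _.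
  by rewrite mulrBr.
by case: (a \in K); rewrite /= ?mul0r ?mul1r; lra.
Qed.

(* The stationary measure on paths of length [L], divided by the number of
   times at which such a path may hit a given vertex. *)
Definition soup L (S : seq V) : seq (R * seq V) :=
  [seq (dg a / L.+1%:R * i.1, i.2) | a <- S, i <- walks L a].

Lemma soup_ge0 L S i : i \in soup L S -> 0 <= i.1.
Proof.
move=> /allpairsPdep[z [j [_ /walks_ge0 j0 ->]]] /=.
by rewrite !mulr_ge0 ?invr_ge0.
Qed.

Lemma expect_soup L S f : expect (soup L S) f =
  L.+1%:R^-1 * \sum_(a <- S) dg a * expect (walks L a) f.
Proof.
rewrite /expect big_allpairs_dep /= mulr_sumr; apply: eq_bigr => a _.
rewrite !mulr_sumr; apply: eq_bigr => i _; rewrite !mulrA; congr (_ * _ * _).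
exact: mulrC.
Qed.

(** By reversibility the starting masses reaching [x] at time [i] add up to [deg x], provided that
    [S] contains the ball around [x]. The hitting mass is therefore independent of the choice of
    [S]. *)
Lemma soup_hit L S K : uniq S -> {in K, forall x, {subset gball nbr L x <= S}} ->
  expect (soup L S) (fun c => (has (mem K) c)%:R) = cesaro_cap R nbr L K.
Proof.
move=> uS KS; rewrite expect_soup.
under eq_bigr do rewrite expect_hit mulr_sumr.
rewrite exchange_big /= mulr_sumr /cesaro_cap.
rewrite big_seq [RHS]big_seq; apply: eq_bigr => x; rewrite mem_undup => xK.
rewrite mulrCA; congr (_ * _).
under eq_bigr do rewrite mulr_sumr.
rewrite exchange_big /= mulr_sumr.
(* Time reversal turns the remaining time [L - i] into the averaging index. *)
rewrite [RHS](reindex_inj rev_ord_inj) /=; apply: eq_bigr => i _.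
rewrite subSS.
under eq_bigr do rewrite mulrA pstep_rev //.
rewrite -mulr_suml -mulr_sumr pstep_sum ?mulr1 // => y yi.
by apply: (KS x xK); apply: gball_mono yi; rewrite -ltnS.
Qed.

(** Each of the [L + 1] visit times contributes at most [deg y * green L y w] after reversal, which
    the normalisation cancels; the factor 2 counts the two orders of visit, equal by
    reversibility. *)
Lemma soup_pair L S x z : uniq S ->
  expect (soup L S) (fun c => ((x \in c) && (z \in c))%:R) <=
  2 * dg x * green L x z.
Proof.
move=> uS.
have half y w : expect (soup L S) (npairs y w) <= dg y * green L y w.
  rewrite expect_soup ler_pdivrMl ?ltr0n //.
  apply: (@le_trans _ _ (\sum_(a <- S) \sum_(i < L.+1)
      dg y * p i y a * green L y w)).
    apply: ler_sum => a _; under eq_bigr do rewrite pstep_rev // -mulrA.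
    by rewrite -mulr_sumr -mulr_suml ler_wpM2l ?ler0n ?expect_npairs.
  rewrite exchange_big /= mulrC.
  under eq_bigr do rewrite -mulr_suml -mulr_sumr mulrAC.
  apply: (@le_trans _ _ (\sum_(i < L.+1) dg y * green L y w)).
    apply: ler_sum => i _; rewrite ler_piMr ?mulr_ge0 ?ler0n ?green_ge0 //.
    exact: pstep_sum_le.
  by rewrite sumr_const card_ord mulr_natr.
apply: le_trans (expect_le _ (mem_npairs x z)) _; first exact: soup_ge0.
rewrite expectD -mulrA mulr_natl mulr2n lerD //.
apply: le_trans (half z x) _; rewrite /green !mulr_sumr.
by apply: ler_sum => i _; rewrite pstep_rev.
Qed.

End Soup.

(** * Chains of independent events *)

Section Bernoulli.
Variables (R : realType) (T : finType) (q : T -> R).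
Hypotheses (q0 : forall t, 0 <= q t) (q1 : forall t, q t <= 1).

Definition bern (w : {ffun T -> bool}) : R :=
  \prod_t (if w t then q t else 1 - q t).

Definition bprob (E : pred {ffun T -> bool}) : R := \sum_w bern w * (E w)%:R.

Lemma bern_ge0 w : 0 <= bern w.
Proof. by apply: prodr_ge0 => t _; case: ifP => _; rewrite ?subr_ge0. Qed.

(** Independence: products over coordinates factorise. The next two lemmas apply it to
    indicators. *)
Lemma bern_prod (f : T -> bool -> R) :
  \sum_w bern w * \prod_t f t (w t) =
  \prod_t (q t * f t true + (1 - q t) * f t false).
Proof.
transitivity (\prod_t \sum_b (if b then q t else 1 - q t) * f t b); last first.
  by apply: eq_bigr => t _; rewrite big_bool.
rewrite bigA_distr_bigA; apply: eq_bigr => w _.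
by rewrite -big_split.
Qed.

Lemma bprob_void (H : pred T) :
  bprob (fun w => [forall t, H t ==> ~~ w t]) = \prod_(t | H t) (1 - q t).
Proof.
transitivity (\sum_w bern w * \prod_t (if H t && w t then 0 else 1 : R)).
  rewrite /bprob; apply: eq_bigr => w _; congr (_ * _).
  have [/forallP h|] := boolP [forall t, H t ==> ~~ w t].
    by rewrite big1 // => t _; have := h t; case: (H t); case: (w t).
  rewrite negb_forall => /existsP[t]; rewrite negb_imply negbK => Hwt.
  by rewrite (bigD1 t) //= Hwt mul0r.
rewrite (bern_prod (fun t b => if H t && b then 0 else 1)) [RHS]big_mkcond /=.
apply: eq_bigr => t _; rewrite andbT andbF mulr1.
by case: (H t); rewrite ?mulr0 ?add0r // mulr1 addrC subrK.
Qed.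

Lemma bprob_all (c : seq T) : uniq c ->
  bprob (fun w => all w c) = \prod_(t <- c) q t.
Proof.
move=> uc.
transitivity (\sum_w bern w * \prod_t (if (t \in c) && ~~ w t then 0 else 1 : R)).
  rewrite /bprob; apply: eq_bigr => w _; congr (_ * _).
  have [/allP h|/allPn[t tc wt]] := boolP (all w c).
    rewrite big1 // => t _; case: ifP => // /andP[/h wt].
    by rewrite wt.
  by rewrite (bigD1 t) //= tc wt mul0r.
rewrite (bern_prod (fun t b => if (t \in c) && ~~ b then 0 else 1)).
rewrite (big_uniq _ uc) /= [RHS]big_mkcond /=.
apply: eq_bigr => t _; rewrite andbT andbF mulr1.
by case: (t \in c); rewrite ?mulr0 ?addr0 // mulr1 addrC subrK.
Qed.

Lemma bprobT : bprob predT = 1.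
Proof.
have := bprob_all (c := [::]) isT; rewrite big_nil => <-.
by apply: eq_bigr.
Qed.

Lemma bprob_ge0 E : 0 <= bprob E.
Proof. by apply: sumr_ge0 => w _; rewrite mulr_ge0 ?bern_ge0 ?ler0n. Qed.

Lemma bprob_le (E F : pred {ffun T -> bool}) : subpred E F -> bprob E <= bprob F.
Proof.
move=> EF; apply: ler_sum => w _; rewrite ler_wpM2l ?bern_ge0 // ler_nat.
by have := EF w; case: (E w) => // ->.
Qed.

Lemma bprob_disjoint (E F G : pred {ffun T -> bool}) :
  (forall w, (G w = E w + F w :> nat)%N) -> bprob G = bprob E + bprob F.
Proof.
move=> h; rewrite /bprob -big_split /=; apply: eq_bigr => w _.
by rewrite -mulrDr -natrD -h.
Qed.

Section Chain.
Variables (e : rel T) (a b : pred T).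

Fixpoint chains k t : seq (seq T) :=
  if k is k'.+1 then
    [:: t] :: [seq t :: c | u <- [seq u <- enum T | e t u], c <- chains k' u]
  else [::].

Lemma mem_chains k t c : path e t c -> (size c < k)%N -> t :: c \in chains k t.
Proof.
elim: k t c => [|k IH] t [|u c] //=; rewrite inE ?eqxx // => /andP[tu uc] ck.
apply/orP; right; apply/allpairsPdep; exists u, (u :: c); split => //.
  by rewrite mem_filter tu mem_enum.
exact: IH.
Qed.

(** Only for duplicate-free chains is the product the probability of presence; chains with
    repetitions are kept, which only enlarges the sum and gives the recursion [chain_massS]. *)
Definition chain_mass k t : R :=
  \sum_(c <- chains k t) (b (last t c))%:R * \prod_(u <- c) q u.

Lemma last_chains k t c : c \in chains k t -> forall u, last u c = last t c.
Proof.
by case: k => // k /=; rewrite inE => /predU1P[->|/allpairsPdep[u [d [_ _ ->]]]].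
Qed.

Lemma chain_massS k t :
  chain_mass k.+1 t = q t * ((b t)%:R + \sum_(u | e t u) chain_mass k u).
Proof.
rewrite /chain_mass /= big_cons /= big_seq1 big_allpairs_dep mulrDr.
rewrite [q t * (b t)%:R]mulrC; congr (_ + _).
rewrite big_filter big_enum_cond mulr_sumr; apply: eq_bigr => u _.
rewrite mulr_sumr big_seq [RHS]big_seq; apply: eq_bigr => c cu /=.
by rewrite big_cons mulrCA (last_chains cu).
Qed.

(** Union bound over loop-erased chains: they are duplicate-free, so their members are present
    independently, and they have at most [#|T|] members. *)
Lemma bprob_chain :
  bprob (fun w => [exists t, [exists u, [&& a t, b u, w t &
    connect [rel t u | [&& e t u, w t & w u]] t u]]]) <=
  \sum_(t | a t) chain_mass #|T| t.
Proof.
apply: (@le_trans _ _ (\sum_w bern w * \sum_(t | a t) \sum_(c <- chains #|T| t)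
    (b (last t c) && uniq c && all w c)%:R)); last first.
  under eq_bigr do rewrite mulr_sumr.
  rewrite exchange_big /=; apply: ler_sum => t _.
  under eq_bigr do rewrite mulr_sumr.
  rewrite exchange_big /=; apply: ler_sum => c _.
  case: (b _); last by rewrite mul0r big1 // => w _; rewrite mulr0.
  rewrite mul1r /=; case: (boolP (uniq c)) => uc /=.
    by rewrite -bprob_all.
  rewrite big1 ?prodr_ge0 // => w _; exact: mulr0.
apply: ler_sum => w _; rewrite ler_wpM2l ?bern_ge0 //.
have nn t : 0 <= \sum_(c <- chains #|T| t)
    (b (last t c) && uniq c && all w c)%:R :> R.
  by apply: sumr_ge0 => c _; exact: ler0n.
case: existsP => [[t /existsP[u /and4P[at_ bu wt /connectP[s]]]]|_]; last first.
  by rewrite sumr_ge0.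
move=> /shortenP[c tc uc _] ut; rewrite (bigD1 t) //= ler_wpDr ?sumr_ge0 //.
have ec : path e t c.
  by apply: sub_path tc => ? ? /and3P[].
have wc : all w (t :: c).
  rewrite /= wt; elim: (c) (t) tc => //= v d IH v' /andP[/and3P[_ _ ->]].
  exact: IH.
have h : t :: c \in chains #|T| t.
  apply: mem_chains => //.
  by rewrite -[(size c).+1]/(size (t :: c)) -(card_uniqP uc) max_card.
rewrite (big_rem (t :: c)) //= ler_wpDr ?sumr_ge0 //.
by move: uc wc => /= -> ->; rewrite -ut bu.
Qed.

End Chain.
End Bernoulli.

(** * Clusters of a path soup *)

Section PathSoup.
Variables (R : realType) (V : eqType) (nbr : V -> seq V) (D : nat).
Hypotheses (sg : simple_graph nbr) (degD : degree_bounded nbr D).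
Variables (s : seq (R * seq V)) (u : R).
Hypotheses (s0 : {in s, forall i, 0 <= i.1}) (u0 : 0 <= u).

Local Notation T := ('I_(size s)).
Local Notation dg x := ((deg nbr x)%:R : R).

Let it (t : T) := tnth (in_tuple s) t.
Let rg t := (it t).2.

Let it0 t : 0 <= (it t).1. Proof. by apply/s0/mem_tnth. Qed.

(** Probability that a Poisson variable of mean [u] times the weight is nonzero; multiplicities do
    not affect the trace. *)
Definition present (t : T) : R := 1 - expR (- (u * (it t).1)).

Lemma present_ge0 t : 0 <= present t.
Proof. by rewrite subr_ge0 -expR0 ler_expR oppr_le0 mulr_ge0. Qed.

Lemma present_le1 t : present t <= 1.
Proof. by rewrite gerBl expR_ge0. Qed.

Lemma present_le t : present t <= u * (it t).1.
Proof. by have := expR_ge1Dx (- (u * (it t).1)); rewrite /present; lra. Qed.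

Definition trace (w : {ffun T -> bool}) : set V :=
  [set x | exists2 t, w t & x \in rg t].

Definition sprob (E : set (set V)) : R := bprob present (fun w => `[< E (trace w) >]).

Lemma sprob_ge0 E : 0 <= sprob E.
Proof. exact: (bprob_ge0 present_ge0 present_le1). Qed.

Lemma sprobT : sprob setT = 1.
Proof.
rewrite -(bprobT present); apply: eq_bigr => w _; congr (_ * _%:R).
by congr nat_of_bool; apply/asboolP.
Qed.

Lemma sprob_disjoint E F : E `&` F = set0 -> sprob (E `|` F) = sprob E + sprob F.
Proof.
move=> EF; apply: bprob_disjoint => w.
have [h|h] := asboolP (E (trace w)); have [k|k] := asboolP (F (trace w)).
- by have : set0 (trace w) by rewrite -EF.
- by rewrite asboolT //; left.
- by rewrite asboolT //; right.
- by rewrite asboolF // => -[].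
Qed.

Lemma sprob_le1 E : sprob E <= 1.
Proof.
rewrite -sprobT -(setUv E) sprob_disjoint ?setICr // lerDl; exact: sprob_ge0.
Qed.

Lemma sum_items (F : R * seq V -> R) : \sum_t F (it t) = \sum_(i <- s) F i.
Proof. by rewrite [RHS]big_tnth. Qed.

Lemma sprob_void (K : seq V) : sprob [set A | forall x, x \in K -> ~ A x] =
  expR (- (u * expect s (fun c => (has (mem K) c)%:R))).
Proof.
transitivity (\prod_(t | has (mem K) (rg t)) (1 - present t)).
  rewrite -bprob_void; apply: eq_bigr => w _; congr (_ * _%:R).
  congr nat_of_bool; apply/asboolP/forallP => [h t|h x xK [t wt xt]].
    apply/implyP => /hasP[x xt xK]; apply/negP => wt.
    by apply: (h x xK); exists t.
  by have /implyP/(_ _)/negP := h t; apply => //; apply/hasP; exists x.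
rewrite /expect -sum_items mulr_sumr -sumrN expR_sum big_mkcond /=.
apply: eq_bigr => t _; rewrite -/(rg t); case: (has _ _).
  by rewrite mulr1 /present opprB addrCA subrr addr0.
by rewrite mulr0n !mulr0 oppr0 expR0.
Qed.

Definition connected_in (x y : V) : set (set V) :=
  [set A | A x /\ exists p, [/\ path (adj nbr) x p, all (fun z => `[< A z >]) p
     & last x p = y]].

Let touch : rel T := fun t v => has (fun z => has (mem (rg v)) (nbr z)) (rg t).

(** Cover each vertex of an occupied path by a present item: items covering consecutive vertices
    contain adjacent vertices, hence are related by [touch]. *)
Lemma sprob_connected x y : sprob (connected_in x y) <=
  \sum_(t | x \in rg t) chain_mass present touch (fun t => y \in rg t) #|T| t.
Proof.
apply: le_trans (bprob_chain present_ge0 present_le1 touch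
  (fun t => x \in rg t) (fun t => y \in rg t)).
apply: (bprob_le present_ge0 present_le1) => w /asboolP[[t wt xt] [c [xc wc cy]]].
apply/existsP; exists t; apply/existsP.
elim: c x t wt xt xc wc cy => [|z c IH] x t wt xt /=.
  by move=> _ _ <-; exists t; rewrite xt wt connect0.
move=> /andP[xz zc] /andP[/asboolP[t' wt' zt'] wc] cy.
have [v /and4P[_ yv _ tv]] := IH z t' wt' zt' zc wc cy.
exists v; rewrite xt yv wt /=; apply: connect_trans tv; apply: connect1.
rewrite /= wt wt' !andbT; apply/hasP; exists x => //; apply/hasP.
by exists z.
Qed.

Let mass y := chain_mass present touch (fun t => y \in rg t).

Lemma mass_ge0 y k t : 0 <= mass y k t.
Proof.
apply: sumr_ge0 => c _; rewrite mulr_ge0 ?ler0n //.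
by apply: prodr_ge0 => v _; exact: present_ge0.
Qed.

Let verts y : seq V := undup (y :: flatten [seq i.2 | i <- s]).

Let vertsP y t z : z \in rg t -> z \in verts y.
Proof.
move=> zt; rewrite mem_undup inE; apply/orP; right.
by apply/flattenP; exists (rg t) => //; apply: map_f; exact: mem_tnth.
Qed.

(** The first item of a chain through [x] either contains [y] or has a vertex [z] with a neighbour
    [z'] on the next item. Summing the weights of the first items through both [x] and [z] produces
    the two-point function. *)
Lemma mass_sum_le y k x :
  \sum_(t | x \in rg t) mass y k.+1 t <=
  \sum_(z <- verts y) (u * expect s (fun c => ((x \in c) && (z \in c))%:R)) *
    ((z == y)%:R + \sum_(z' <- nbr z) \sum_(t | z' \in rg t) mass y k t).
Proof.
pose h z : R := (z == y)%:R + \sum_(z' <- nbr z) \sum_(t | z' \in rg t) mass y k t.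
rewrite -[leRHS]/(\sum_(z <- verts y)
  (u * expect s (fun c => ((x \in c) && (z \in c))%:R)) * h z).
have h0 z : 0 <= h z.
  rewrite addr_ge0 ?ler0n //; apply: sumr_ge0 => z' _; apply: sumr_ge0 => t _.
  exact: mass_ge0.
apply: (@le_trans _ _ (\sum_(t | x \in rg t) present t *
    \sum_(z <- verts y) (z \in rg t)%:R * h z)); last first.
  under eq_bigr do rewrite mulr_sumr.
  rewrite exchange_big /=; apply: ler_sum => z _.
  rewrite /expect -sum_items mulr_sumr mulr_suml big_mkcond /=.
  apply: ler_sum => t _; rewrite -/(rg t).
  case: (x \in rg t); last by rewrite mulr0n !mulr0 mul0r.
  rewrite /= [u * _]mulrA -[leRHS]mulrA ler_wpM2r ?present_le //.
  by rewrite mulr_ge0 ?ler0n.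
apply: ler_sum => t _; rewrite /mass chain_massS ler_wpM2l ?present_ge0 //.
rewrite /h; under [leRHS]eq_bigr do rewrite mulrDr.
rewrite big_split /=; apply: lerD.
  under eq_bigr do rewrite mulrC.
  rewrite sum_delta ?undup_uniq //.
  by case: (boolP (y \in rg t)) => [/(vertsP y) ->|]; rewrite ?mul1r ?mulr0.
(* Bound the indicator of [touch] by the number of adjacent pairs [(z, z')]. *)
apply: (@le_trans _ _ (\sum_v (\sum_(z <- verts y) \sum_(z' <- nbr z)
   (z \in rg t)%:R * (z' \in rg v)%:R) * mass y k v)).
  rewrite big_mkcond /=; apply: ler_sum => v _.
  have nn z z' : 0 <= (z \in rg t)%:R * (z' \in rg v)%:R :> R.
    by rewrite mulr_ge0 ?ler0n.
  case: ifP => [/hasP[z zt /hasP[z' zz' z'v]]|_]; last first.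
    rewrite mulr_ge0 ?mass_ge0 //; do 2 apply: sumr_ge0 => ? _; exact: nn.
  have {}z'v : z' \in rg v by [].
  rewrite ler_peMl ?mass_ge0 //.
  rewrite (big_rem z) ?(vertsP y zt) //= (big_rem z') //= zt z'v mulr1 -addrA.
  by rewrite lerDl addr_ge0 //; repeat (apply: sumr_ge0 => ? _ //).
under [leLHS]eq_bigr do rewrite mulr_suml.
rewrite exchange_big /=; apply: ler_sum => z _.
under [leLHS]eq_bigr do rewrite mulr_suml.
rewrite exchange_big /= mulr_sumr; apply: ler_sum => z' _.
rewrite mulr_sumr [leRHS]big_mkcond /=; apply: ler_sum => v _.
by case: (z' \in rg v); rewrite ?mulr1 // mulr0 mul0r.
Qed.

Variable L : nat.
Hypothesis two_point : forall x z,
  expect s (fun c => ((x \in c) && (z \in c))%:R) <= 2 * dg x * green R nbr L x z.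
Hypothesis dpos : forall x, (0 < deg nbr x)%N.

(** One factor [D] bounds the degree in [two_point], the other the number of neighbours through
    which a chain passes to its next item. *)
Let eps : R := 2 * u * D%:R ^+ 2.

(** Each further item costs [L.+1] more generations by [green_gen_fun]. The number [N] depends on
    [k], but later bounds on [gen_fun] are uniform in [N]. *)
Lemma mass_gen_fun y k : exists N, forall x,
  \sum_(t | x \in rg t) mass y k t <=
  2 * u * D%:R * gen_fun nbr (1 + eps) N x y.
Proof.
have eps0 : 0 <= eps by rewrite !mulr_ge0 ?exprn_ge0 ?ler0n.
have c0 : 0 <= 2 * u * D%:R by rewrite !mulr_ge0 ?ler0n.
elim: k => [|k [N IH]].
  exists 0 => x; rewrite /gen_fun big_ord0 mulr0 big1 // => t _.
  by rewrite /mass /chain_mass big_nil.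
exists (N + L.+1)%N => x; apply: le_trans (mass_sum_le y k x) _.
have uv : uniq (verts y) by exact: undup_uniq.
apply: le_trans; last first.
  exact: (ler_wpM2l c0 (green_gen_fun nbr L N x y eps0 uv)).
rewrite mulr_sumr; apply: ler_sum => z _; rewrite mulrA.
have gf0 w : 0 <= gen_fun nbr (1 + eps) N w y.
  by apply: gen_fun_ge0; rewrite addr_ge0.
apply: ler_pM.
- rewrite mulr_ge0 // /expect big_seq sumr_ge0 // => i /s0 i0.
  by rewrite mulr_ge0 ?ler0n.
- rewrite addr_ge0 ?ler0n // sumr_ge0 // => z' _.
  by rewrite sumr_ge0 // => t _; exact: mass_ge0.
- rewrite [2 * u]mulrC -!mulrA ler_wpM2l //.
  apply: le_trans (two_point x z) _; rewrite -mulrA ler_wpM2l //.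
  by rewrite ler_wpM2r ?green_ge0 // ler_nat.
rewrite lerD2l; apply: (@le_trans _ _ (2 * u * D%:R * (dg z *
    avg nbr (gen_fun nbr (1 + eps) N ^~ y) z))).
  rewrite /avg !mulr_sumr; apply: ler_sum => z' _.
  by rewrite [dg z * _]mulrA divff ?mul1r ?pnatr_eq0 -?lt0n.
rewrite -[X in _ <= X * _]/(2 * u * D%:R ^+ 2) expr2 !mulrA.
apply: ler_wpM2r; first exact: avg_ge0.
by apply: ler_wpM2l => //; rewrite ler_nat; exact: degD.
Qed.

Lemma sprob_connected_le x y : exists N, sprob (connected_in x y) <=
  2 * u * D%:R * gen_fun nbr (1 + eps) N x y.
Proof.
have [N hN] := mass_gen_fun y #|T|; exists N.
exact: le_trans (sprob_connected x y) (hN x).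
Qed.

End PathSoup.

(** * Countably additive extension on vertex configurations *)

Definition depends_on (V : eqType) (K : seq V) (E : set (set V)) : Prop :=
  forall A B : set V, {in K, forall x, A x <-> B x} -> E A -> E B.

(** Induction on [K]: split [E] according to the state of [x]; once that state is frozen, the event
    depends on the remaining vertices only. *)
Lemma measurable_depends_on (V : eqType) (K : seq V) (E : set (set V)) :
  depends_on K E -> measurable (E : set (config V)).
Proof.
elim: K E => [|x K IH] E EK.
  have [[A EA]|nE] := pselect (exists A, E A).
    have -> : E = setT by apply/seteqP; split=> // B _; apply: EK EA.
    exact: measurableT.
  have -> : E = set0 by apply/seteqP; split=> // B EB; apply: nE; exists B.
  exact: measurable0.
have mx : measurable ([set A | A x] : set (config V)).
  by apply: sub_sigma_algebra; exists x.
pose set_at (b : Prop) (A : set V) : set V := [set y | (y = x /\ b) \/ (y <> x /\ A y)].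
have mb b : measurable ([set A | E (set_at b A)] : set (config V)).
  apply: IH => A B AB; apply: EK => y; rewrite inE => /predU1P[->|yK].
    by rewrite /set_at /=; split=> -[[_ hb]|[] //]; left.
  by have ABy := AB y yK; rewrite /set_at /=; split; tauto.
have -> : E = ([set A | A x] `&` [set A | E (set_at True A)]) `|`
    (~` [set A | A x] `&` [set A | E (set_at False A)]).
  apply/seteqP; split=> A.
    move=> EA; have [Ax|nAx] := pselect (A x); [left|right]; split => //.
      apply: EK EA => y _; rewrite /set_at /=.
      by have [->|yx] := pselect (y = x); split; tauto.
    apply: EK EA => y _; rewrite /set_at /=.
    by have [->|yx] := pselect (y = x); split; tauto.
  move=> [[/= Ax]|[/= Ax]]; apply: EK => y _; rewrite /set_at /=.
    by have [->|yx] := pselect (y = x); split; tauto.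
  by have [->|yx] := pselect (y = x); split; tauto.
apply: measurableU; apply: measurableI => //; exact: measurableC.
Qed.

Section Extension.
Variables (R : realType) (V : eqType) (v : nat -> V) (idx : V -> nat).
Hypothesis idxK : forall x, v (idx x) = x.
Variable m : set (set V) -> R.
Hypotheses (m_ge0 : forall E, 0 <= m E) (mT : m setT = 1)
  (mU : forall E F, E `&` F = set0 -> m (E `|` F) = m E + m F).

Let m0 : m set0 = 0.
Proof.
have := mU (set0I set0); rewrite setU0 => /eqP.
by rewrite -subr_eq0 opprD addrA subrr sub0r oppr_eq0 => /eqP.
Qed.

(* Most recent state first: [v (n - 1), ..., v 0]. *)
Fixpoint word n (A : set V) : seq bool :=
  if n is n'.+1 then `[< A (v n') >] :: word n' A else [::].

Lemma size_word n A : size (word n A) = n.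
Proof. by elim: n => //= n ->. Qed.

Definition wordset (w : seq bool) : set (set V) := [set A | word (size w) A = w].

Lemma wordset_split w E : m (wordset w `&` E) =
  m (wordset (false :: w) `&` E) + m (wordset (true :: w) `&` E).
Proof.
rewrite -mU.
  congr m; rewrite -setIUl; congr (_ `&` _).
  apply/seteqP; split=> A /=; rewrite /wordset /=.
    by move=> ->; case: `[< _ >]; [right|left].
  by move=> [[_ ->]|[_ ->]].
apply/seteqP; split=> A //=; rewrite /wordset /=.
by move=> [[[-> _] _] [[]]].
Qed.

(* The half-open interval [lft w, lft w + m (wordset w)) codes the word [w]:
   the words of each length partition [0, 1). *)
Fixpoint lft (w : seq bool) : R :=
  if w is b :: w' then lft w' + (if b then m (wordset (false :: w')) else 0)
  else 0.

Definition cell w : set R := `[lft w, lft w + m (wordset w)[%classic.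

Lemma m_wordset w :
  m (wordset w) = m (wordset (false :: w)) + m (wordset (true :: w)).
Proof. by have := wordset_split w setT; rewrite !setIT. Qed.

Lemma cellE w t : cell w t = (lft w <= t < lft w + m (wordset w)).
Proof. by rewrite /cell /= in_itv. Qed.

Lemma cell_split w : cell w = cell (false :: w) `|` cell (true :: w).
Proof.
have h0 := m_ge0 (wordset (false :: w)); have h1 := m_ge0 (wordset (true :: w)).
apply/seteqP; split=> t; rewrite /setU /= !cellE /= addr0 (m_wordset w).
  move=> /andP[t0 t1]; case: (ltP t (lft w + m (wordset (false :: w)))) => ht.
    by left; rewrite t0.
  by right; rewrite -addrA.
by move=> [|] /andP[? ?]; apply/andP; split; lra.
Qed.

Lemma cell_disjoint w : cell (false :: w) `&` cell (true :: w) = set0.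
Proof.
apply/seteqP; split=> t //; rewrite /setI /= !cellE /= addr0.
move=> [/andP[_ h] /andP[h' _]].
by have := lt_le_trans h h'; rewrite ltxx.
Qed.

(** Inverse of the interval coding: the new letter tells whether [t] lies beyond the left part of
    its current cell. *)
Fixpoint decode n (t : R) : seq bool :=
  if n is n'.+1 then
    let w := decode n' t in (lft w + m (wordset (false :: w)) <= t) :: w
  else [::].

Lemma decode_cell w t : cell w t -> decode (size w) t = w.
Proof.
elim: w => // b w IH tb.
have tw : cell w t by rewrite cell_split; case: b tb; [right|left].
move: tb; rewrite cellE /= => /andP[h1 h2].
rewrite (IH tw); congr (_ :: _); case: b h1 h2 => // _.
by rewrite addr0 leNgt => ->.
Qed.

Lemma cell_nil : cell [::] = `[0, 1[%classic.
Proof.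
rewrite /cell.
have -> : wordset [::] = setT by apply/seteqP; split.
by rewrite /= add0r mT.
Qed.

(** Induction on the number [k] of letters still to be read: cells split as words do, and their
    lengths are masses by construction, so finite additivity suffices. *)
Lemma cell_measure (P : pred (seq bool)) k w :
  measurable (cell w `&` [set t | P (decode (size w + k) t)]) /\
  lebesgue_measure (cell w `&` [set t | P (decode (size w + k) t)]) =
  (m (wordset w `&` [set A | P (word (size w + k) A)]))%:E.
Proof.
elim: k w => [|k IH] w.
  rewrite addn0; case: (boolP (P w)) => Pw.
    have -> : cell w `&` [set t | P (decode (size w) t)] = cell w.
      by apply/seteqP; split=> t [] // tw; split => //=; rewrite decode_cell.
    have -> : wordset w `&` [set A | P (word (size w) A)] = wordset w.
      by apply/seteqP; split=> A /= => [[]//|Aw]; split => //; rewrite Aw.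
    split; first exact: measurable_itv.
    rewrite /cell lebesgue_measure_itv /= lte_fin ltrDl.
    have := m_ge0 (wordset w); rewrite le_eqVlt => /predU1P[<-|->].
      by rewrite ltxx.
    by rewrite -EFinB addrAC subrr add0r.
  have -> : cell w `&` [set t | P (decode (size w) t)] = set0.
    apply/seteqP; split=> t //= [/decode_cell ->].
    by rewrite (negPf Pw).
  have -> : wordset w `&` [set A | P (word (size w) A)] = set0.
    by apply/seteqP; split=> A //= [->]; rewrite (negPf Pw).
  by rewrite measure0 m0; split => //; exact: measurable0.
have [m0w e0] := IH (false :: w); have [m1w e1] := IH (true :: w).
rewrite addnS -addSn cell_split setIUl wordset_split.
split; first exact: measurableU.
rewrite measureU //; first by rewrite EFinD; congr (_ + _)%E.
by rewrite setIACA cell_disjoint set0I.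
Qed.

Definition decoded (t : R) : config V :=
  [set x | `[0, 1[%classic t /\ head false (decode (idx x).+1 t)].

Lemma measurable_decoded : measurable_fun setT decoded.
Proof.
refine (@measurability _ _ (measurableTypeR R) (config V) setT decoded
  (@cyl V) erefl _).
move=> _ [_ [x _ <-] <-].
have [mx _] := cell_measure (head false) (idx x).+1 [::].
by rewrite setTI; move: mx; rewrite cell_nil.
Qed.

Let unit_measurable : measurable (`[0, 1[%classic : set R).
Proof. exact: measurable_itv. Qed.

(** Image of Lebesgue measure on [[0, 1)] under [decoded]; countable additivity is inherited. *)
Definition extension (E : set (config V)) : \bar R :=
  lebesgue_measure (`[0, 1[%classic `&` decoded @^-1` E).

Let measurable_pre (E : set (config V)) : measurable E ->
  measurable (`[0, 1[%classic `&` decoded @^-1` E).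
Proof.
move=> mE; apply: measurableI => //.
by rewrite -[X in measurable X]setTI; exact: measurable_decoded.
Qed.

Let extension0 : extension set0 = 0%E.
Proof. by rewrite /extension preimage_set0 setI0 measure0. Qed.

Let extension_ge0 E : (0 <= extension E)%E.
Proof. exact: measure_ge0. Qed.

Let extension_sigma_additive : semi_sigma_additive extension.
Proof.
move=> F mF tF mUF; rewrite /extension preimage_bigcup setI_bigcupr.
apply: measure_semi_sigma_additive.
- by move=> n; exact: measurable_pre.
- apply: trivIset_setIl; apply/trivIsetP => i j _ _ ij; rewrite -preimage_setI.
  by move/trivIsetP : tF => /(_ _ _ _ _ ij) -> //; rewrite preimage_set0.
- by rewrite -setI_bigcupr -preimage_bigcup; exact: measurable_pre.
Qed.

HB.instance Definition _ := isMeasure.Build _ _ _ extension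
  extension0 extension_ge0 extension_sigma_additive.

Let extensionT : extension setT = 1%E.
Proof.
rewrite /extension preimage_setT setIT lebesgue_measure_itv /= lte_fin ltr01.
by rewrite -EFinB subr0.
Qed.

HB.instance Definition _ := Measure_isProbability.Build _ _ _ extension extensionT.

(** Words carry the newest letter first, hence [rev]; [v] may repeat vertices, and [x] is read at
    the index [idx x]. *)
Definition state (w : seq bool) (x : V) := nth false (rev w) (idx x).

Let state_word n A x : (idx x < n)%N -> state (word n A) x = `[< A x >].
Proof.
rewrite /state; elim: n => // n IH; rewrite ltnS leq_eqVlt /= rev_cons.
rewrite nth_rcons size_rev size_word => /predU1P[<-|xn].
  by rewrite ltnn eqxx idxK.
by rewrite xn IH.
Qed.

Lemma size_decode n t : size (decode n t) = n.
Proof. by elim: n => //= n ->. Qed.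

Let state_decode n t x : (idx x < n)%N ->
  state (decode n t) x = head false (decode (idx x).+1 t).
Proof.
rewrite /state; elim: n => // n IH; rewrite ltnS leq_eqVlt /= rev_cons.
rewrite nth_rcons size_rev size_decode => /predU1P[<-|xn].
  by rewrite ltnn eqxx.
by rewrite xn IH.
Qed.

(** Once [n] exceeds the indices of [K], the event is a predicate of the word of length [n], to
    which [cell_measure] applies. *)
Lemma extensionE (K : seq V) (E : set (set V)) :
  depends_on K E -> extension E = (m E)%:E.
Proof.
move=> EK.
have [n Kn] : exists n, forall x, x \in K -> (idx x < n)%N.
  exists (\max_(x <- K) idx x).+1 => x xK.
  by rewrite ltnS (big_rem x) //= leq_maxl.
pose P w := `[< E [set x | state w x] >].
have h : lebesgue_measure (`[0, 1[%classic `&` [set t | P (decode n t)]) =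
    (m (wordset [::] `&` [set A | P (word n A)]))%:E.
  by have [_] := cell_measure P n [::]; rewrite cell_nil.
transitivity (lebesgue_measure (`[0, 1[%classic `&` [set t | P (decode n t)])).
  rewrite /extension; congr lebesgue_measure; apply/seteqP; split=> t /= [t01].
    move=> Et; split => //; apply/asboolP; apply: EK Et => x /Kn xn /=.
    by rewrite state_decode //; split => // -[].
  move=> /asboolP Et; split => //; apply: EK Et => x /Kn xn /=.
  by rewrite state_decode //; split => // -[].
rewrite h; congr (m _)%:E; apply/seteqP; split=> A /=.
  move=> [_ /asboolP]; apply: EK => x /Kn xn /=.
  by rewrite state_word //; split => /asboolP.
move=> EA; split => //; apply/asboolP; apply: EK EA => x /Kn xn /=.
by rewrite state_word //; split => /asboolP.
Qed.

Lemma finitely_additive_extension :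
  exists mu : probability (config V) R, forall (K : seq V) (E : set (set V)),
    depends_on K E -> mu E = (m E)%:E.
Proof. by exists extension; exact: extensionE. Qed.

End Extension.

(** * The interlacement law *)

Section UltraLimit.
Variable (R : realType).

(** Compactness of [[0, 1]] gives a cluster point, and along an ultrafilter a cluster point is a
    limit. *)
Lemma ultra_bounded_cvg (U : set_system nat) (f : nat -> R) : UltraFilter U ->
  (forall n, 0 <= f n <= 1) -> cvg (f @ U).
Proof.
move=> UU f01.
have [p [_ pf]] : `[0, 1]%classic `&` cluster (f @ U) !=set0.
  apply: segment_compact; rewrite nbhs_simpl /=.
  by apply: filterE => n; rewrite /= in_itv /=.
apply/cvg_ex; exists p => A pA.
case: (in_ultra_setVsetC (f @^-1` A) UU) => // nA.
have [t [/= nAt At]] : ~` A `&` A !=set0 by exact: pf.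
by [].
Qed.

End UltraLimit.

(** * Countability of the vertex set and positivity of degrees *)

Section Graph.
Variables (V : eqType) (nbr : V -> seq V).

(** By connectedness and local finiteness every vertex is reached from [x] by a finite list of
    neighbour indices, and such lists are countable. *)
Lemma walk_code (x : V) : connected_graph nbr ->
  exists (v : nat -> V) (idx : V -> nat), forall y, v (idx y) = y.
Proof.
move=> cg; pose pos (s : seq nat) := foldl (fun z i => nth z (nbr z) i) x s.
have posP y : exists s, pos s == y.
  have [p [xp <-]] := cg x y; rewrite /pos.
  elim: p (x) xp => [|z p IH] w /=; first by exists [::].
  move=> /andP[wz /IH[s /eqP sz]].
  by exists (index z (nbr w) :: s); rewrite /= nth_index ?sz.
exists (fun n => oapp pos x (unpickle n)), (fun y => pickle (xchoose (posP y))).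
by move=> y; rewrite pickleK /=; exact/eqP/(xchooseP (posP y)).
Qed.

Lemma deg_gt0 : infinite_graph V -> connected_graph nbr ->
  forall x, (0 < deg nbr x)%N.
Proof.
move=> ig cg x; have [y yx] := ig [:: x].
have [p [xp py]] := cg x y; rewrite /deg.
case: p xp py => [|z p] /=; first by move=> _ xy; rewrite xy inE eqxx in yx.
by rewrite /adj; case: (nbr x).
Qed.

End Graph.

(** * Limit of the soups along an ultrafilter *)

Section Interlacement.
Variables (R : realType) (V : eqType) (nbr : V -> seq V) (D : nat).
Hypotheses (sg : simple_graph nbr) (dpos : forall x, (0 < deg nbr x)%N)
  (degD : degree_bounded nbr D).
Variables (v : nat -> V) (idx : V -> nat) (idxK : forall x, v (idx x) = x).
Variables (u : R) (u0 : 0 <= u).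

(** For a fixed finite [K], this contains all balls of radius [L] around [K] as soon as [L] exceeds
    the indices of [K], as [soup_hit] requires. *)
Definition starts L : seq V := undup (flatten [seq gball nbr L (v i) | i <- iota 0 L]).

Definition approx L (E : set (set V)) : R := sprob (soup R nbr L (starts L)) u E.

Lemma approx_void (K : seq V) :
  approx L [set A | forall x, x \in K -> ~ A x] @[L --> \oo] -->
  expR (- (u * cap nbr R K)).
Proof.
apply: (@cvg_trans _ ((fun L => expR (- (u * cesaro_cap R nbr L K))) @ \oo)).
  apply: near_eq_cvg; near=> L.
  rewrite /approx sprob_void soup_hit ?undup_uniq // => x xK y yx.
  rewrite mem_undup; apply/flattenP; exists (gball nbr L x) => //.
  apply/mapP; exists (idx x); last by rewrite idxK.
  rewrite mem_iota /= add0n.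
  have : (\max_(z <- K) idx z < L)%N by near: L; exact: nbhs_infty_gt.
  by apply: leq_ltn_trans; rewrite (big_rem x) //= leq_maxl.
apply: (@cvg_comp _ _ _ _ expR).
  by apply: cvgN; apply: cvgM; [exact: cvg_cst|exact: cesaro_cap_cvg].
exact: continuous_expR.
Unshelve. all: by end_near.
Qed.

Lemma approx_connected_le L x y : exists N,
  approx L (connected_in nbr x y) <=
  2 * u * D%:R * gen_fun nbr (1 + 2 * u * D%:R ^+ 2) N x y.
Proof.
apply: sprob_connected_le => //; first exact: soup_ge0.
by move=> ? ?; apply: soup_pair => //; exact: undup_uniq.
Qed.

(** Along an ultrafilter finer than [\oo] all events have a limit at once; additivity and bounds
    pass to it, and void probabilities keep their ordinary limits. *)
Lemma connected_limit : exists m : set (set V) -> R,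
  [/\ (forall E, 0 <= m E) /\ m setT = 1,
      forall E F, E `&` F = set0 -> m (E `|` F) = m E + m F,
      forall K : seq V, m [set A | forall x, x \in K -> ~ A x] =
        expR (- (u * cap nbr R K))
    & forall x y (B : R), (forall N, 2 * u * D%:R *
        gen_fun nbr (1 + 2 * u * D%:R ^+ 2) N x y <= B) ->
        m (connected_in nbr x y) <= B].
Proof.
have [U [UU sU]] := @ultraFilterLemma nat \oo _.
have cv E : cvg (approx L E @[L --> U]).
  apply: ultra_bounded_cvg => L; rewrite sprob_ge0 ?sprob_le1 //; exact: soup_ge0.
exists (fun E => lim (approx L E @[L --> U])); split.
- split=> [E|].
    by apply: limr_ge => //; apply: filterE => L; apply: sprob_ge0 => //; exact: soup_ge0.
  by apply: lim_near_cst => //; apply: filterE => L; exact: sprobT.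
- move=> E F EF; rewrite -limD //; congr (lim _); congr (_ @ U).
  by apply/funext => L; exact: sprob_disjoint.
- by move=> K; apply: cvg_lim => // A /(@approx_void K) /sU.
- move=> x y B hB; apply: limr_le => //; apply: filterE => L.
  by have [N hN] := approx_connected_le L x y; exact: le_trans hN (hB N).
Qed.

End Interlacement.

(** * Disconnection at low intensity *)

Section Main.
Variables (R : realType) (V : eqType) (nbr : V -> seq V) (D : nat).

(** Terms below [n] vanish since [y] is out of reach; the others are bounded by a geometric tail. *)
Lemma gen_fun_le (s r : R) n N x y : 0 <= s -> 0 <= r -> s * r < 1 ->
  (forall m, pstep nbr R m x y <= D%:R * r ^+ m) -> y \notin gball nbr n x ->
  gen_fun nbr s N x y <= D%:R * ((s * r) ^+ n / (1 - s * r)).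
Proof.
move=> s0 r0 sr1 pr yn; set t := s * r.
have t0 : 0 <= t by exact: mulr_ge0.
have t1 : 0 < 1 - t by rewrite subr_gt0.
suff h : gen_fun nbr s N x y + D%:R * (t ^+ maxn N n / (1 - t)) <=
    D%:R * (t ^+ n / (1 - t)).
  by apply: le_trans h; rewrite lerDl mulr_ge0 ?ler0n // divr_ge0 ?exprn_ge0 ?(ltW t1).
elim: N => [|N IH]; first by rewrite /gen_fun big_ord0 add0r max0n.
apply: le_trans IH; rewrite /gen_fun big_ord_recr -addrA lerD2l.
have [Nn|nN] := ltnP N n.
  have -> : pstep nbr R N x y = 0.
    apply: pstep_gball; apply: contra yn; exact/gball_mono/ltnW.
  by rewrite mulr0 add0r (maxn_idPr Nn).
rewrite (maxn_idPl (leqW nN)).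
have -> : D%:R * (t ^+ N / (1 - t)) = D%:R * t ^+ N + D%:R * (t ^+ N.+1 / (1 - t)).
  rewrite exprS; field; exact/lt0r_neq0.
by rewrite lerD2r [t ^+ N]exprMn mulrCA ler_wpM2l ?exprn_ge0.
Qed.

Lemma expr_small (t C e : R) : 0 <= t -> t < 1 -> 0 < e -> exists n, C * t ^+ n < e.
Proof.
move=> t0 t1 e0; apply: contrapT => /forallNP h.
have {}h n : e <= C * t ^+ n by rewrite leNgt; exact/negP.
have tp : 0 < t.
  rewrite lt_neqAle t0 andbT; apply/negP => /eqP t0'.
  by have := h 1; rewrite -t0' expr1 mulr0 leNgt e0.
have : t^-1 <= 1.
  apply: (@expr_bounded_le1 _ _ (C / e) 0) => k _.
  by rewrite ler_pdivlMr // exprVn mulrC ler_pdivrMr ?exprn_gt0.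
by rewrite leNgt invf_gt1 // t1.
Qed.

Hypotheses (sg : simple_graph nbr) (ig : infinite_graph V)
  (cg : connected_graph nbr) (degD : degree_bounded nbr D).

Let dpos := deg_gt0 ig cg.

Lemma escape_sub (K K' : seq V) x : {subset K <= K'} ->
  escape nbr R K' x <= escape nbr R K x.
Proof.
move=> KK'; have KK'n n : avoid nbr R K' n x <= avoid nbr R K n x.
  elim: n x => [|n IH] x //=; apply: ler_sum => z _.
  rewrite ler_wpM2l ?invr_ge0 //; case: (boolP (z \in K)) => [/KK' ->|zK].
    by rewrite !mul0r.
  by rewrite mul1r (le_trans _ (IH z)) // ler_piMl ?avoid_ge0 // lern1 leq_b1.
have c := @avoid_cvg R V nbr dpos K x; have c' := @avoid_cvg R V nbr dpos K' x.
rewrite -(cvg_lim _ c) // -(cvg_lim _ c') //.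
apply: ler_lim; [exact: cvgP c'|exact: cvgP c|exact: nearW].
Qed.

Lemma cap1 x : cap nbr R [:: x] = (deg nbr x)%:R * escape nbr R [:: x] x.
Proof. by rewrite /cap /= big_seq1 /Defs.eq_measure inE eqxx mul1r. Qed.

Lemma cap2_le x y : x != y ->
  cap nbr R [:: x; y] <= cap nbr R [:: x] + cap nbr R [:: y].
Proof.
move=> xy; rewrite !cap1 /cap /= inE (negPf xy) big_cons big_seq1.
rewrite /Defs.eq_measure !inE !eqxx orbT !mul1r lerD //.
  by apply: ler_wpM2l; [exact: ler0n|apply: escape_sub => z; rewrite !inE => ->].
apply: ler_wpM2l; first exact: ler0n.
by apply: escape_sub => z; rewrite !inE => ->; rewrite orbT.
Qed.

(** The limit [m] and its extension agree on events of finitely many vertices only; confining the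
    path to indices below [n] gives such events, increasing to [connected_in]. *)
Definition connected_within (idx : V -> nat) n x y : set (set V) :=
  [set A | A x /\ exists p, [/\ path (adj nbr) x p,
     all (fun z => `[< A z >] && (idx z < n)%N) p & last x p = y]].

Lemma connected_withinW idx n x y :
  connected_within idx n x y `<=` connected_in nbr x y.
Proof.
move=> A [Ax [p [xp pA py]]]; split => //; exists p; split => //.
by apply: sub_all pA => z /andP[].
Qed.

Lemma connected_in_bigcup idx x y :
  connected_in nbr x y `<=` \bigcup_n connected_within idx n x y.
Proof.
move=> A [Ax [p [xp pA py]]]; exists (\max_(z <- p) idx z).+1 => //; split => //.
exists p; split => //; apply/allP => z zp; rewrite (allP pA) //=.
by rewrite ltnS (big_rem z) //= leq_maxl.
Qed.

Lemma connected_within_le idx x y : {homo (fun n => connected_within idx n x y) :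
  n k / (n <= k)%N >-> n `<=` k}.
Proof.
move=> n k nk A [Ax [p [xp pA py]]]; split => //; exists p; split => //.
by apply: sub_all pA => z /andP[-> /leq_trans]; apply.
Qed.

Lemma connected_within_depends_on (v : nat -> V) idx n x y : (forall z, v (idx z) = z) ->
  depends_on (x :: map v (iota 0 n)) (connected_within idx n x y).
Proof.
move=> idxK A B AB [Ax [p [xp pA py]]]; split.
  by apply/AB => //; rewrite inE eqxx.
exists p; split => //; apply: sub_all pA => z /andP[/asboolP Az zn].
rewrite zn andbT; apply/asboolP/AB => //; rewrite inE -{2}(idxK z).
by rewrite map_f ?orbT // mem_iota.
Qed.

Lemma measurable_connected (v : nat -> V) idx : (forall z, v (idx z) = z) ->
  measurable ([set A | induced_connected nbr A] : set (config V)).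
Proof.
move=> idxK.
have mx x : measurable ([set A | A x] : set (config V)).
  by apply: sub_sigma_algebra; exists x.
have -> : [set A | induced_connected nbr A] = \bigcap_i \bigcap_j
    (~` [set A | A (v j)] `|` ~` [set A | A (v i)] `|`
     \bigcup_n connected_within idx n (v i) (v j)).
  apply/seteqP; split=> A.
    move=> AC i _ j _; have [Ai|] := pselect (A (v i)); last by left; right.
    have [Aj|] := pselect (A (v j)); last by left; left.
    by right; apply: connected_in_bigcup; split => //; exact: AC.
  move=> h x y Ax Ay; have := h (idx x) Logic.I (idx y) Logic.I; rewrite !idxK.
  by move=> [[]//|[n _ /connected_withinW[]]].
apply: bigcapT_measurable => i; apply: bigcapT_measurable => j.
apply: measurableU; first by apply: measurableU; exact: measurableC.
apply: bigcupT_measurable => n.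
exact: (measurable_depends_on (@connected_within_depends_on v idx n _ _ idxK)).
Qed.

(** Joint occupation of [x] and a vertex [b] has probability at least [d] wherever [b] is, while
    connection between them has probability below [d] for [b] far away. *)
Lemma not_ae_connected (u : R) x y :
  unif_escape nbr R -> 0 < u -> 0 < spectral_radius nbr R x y ->
  (1 + 2 * u * D%:R ^+ 2) * spectral_radius nbr R x y < 1 ->
  exists2 mu : probability (config V) R, interlacement_law nbr u mu &
    mu [set A | induced_connected nbr A] != 1%E.
Proof.
move=> [c [c0 cesc]] u0 rho0; set s := 1 + _; set rho := spectral_radius _ _ _ _.
move=> srho; have s0 : 0 < s.
  by rewrite ltr_pwDl // !mulr_ge0 ?exprn_ge0 ?ler0n // ltW.
(* The midpoint of [rho] and [s^-1]. *)
have [r rhor sr1] : exists2 r, rho < r & s * r < 1.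
  exists ((rho + s^-1) / 2); first by rewrite midf_lt // -div1r ltr_pdivlMr // mulrC.
  rewrite mulrC -ltr_pdivlMr // div1r midf_lt // -div1r ltr_pdivlMr // mulrC.
  exact: srho.
have r0 : 0 < r by exact: lt_trans rhor.
have [v [idx idxK]] := walk_code x cg.
have [m [[m0 mT] mU mvoid mconn]] :=
  connected_limit sg dpos degD idxK (ltW u0).
have [mu hmu] := finitely_additive_extension idxK m0 mT mU.
have mD A B : m (A `|` B) = m A + m (B `\` A).
  by rewrite -mU ?setDIK // setUDr setDv setD0.
have mID A B : m B = m (B `&` A) + m (B `\` A).
  by rewrite -mU ?setUIDK //; apply/seteqP; split=> C // -[[_ ?] []].
have m_le A B : A `<=` B -> m A <= m B.
  by move=> AB; rewrite (mID A B) (setIidr AB) lerDl.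
exists mu.
  move=> K; rewrite (hmu K) ?mvoid // => A B AB hA z zK Bz.
  exact: (hA z zK ((AB z zK).2 Bz)).
apply/eqP => muC.
pose d := (1 - expR (- (u * c))) ^+ 2.
have d0 : 0 < d.
  by rewrite exprn_gt0 // subr_gt0 -expR0 ltr_expR oppr_lt0 mulr_gt0.
have [n hn] := @expr_small (s * r) (2 * u * D%:R * (D%:R / (1 - s * r))) d
  (mulr_ge0 (ltW s0) (ltW r0)) sr1 d0.
have [b bn] := ig (gball nbr n x).
have xb : x != b by apply: contraNneq bn => <-; exact: gball_center.
pose both : set (set V) := [set A | A x /\ A b].
(* Inclusion-exclusion, with void events positively correlated by subadditivity of [cap]; single
   capacities are at least [c] because degrees are at least 1. *)
have both_ge : d <= m both.
  pose void K : set (set V) := [set A | forall z, z \in (K : seq V) -> ~ A z].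
  have split1 : m setT = m both + m (void [:: x] `|` void [:: b]).
    rewrite -mU.
      congr m; apply/seteqP; split=> // A _.
      have [Ax|nAx] := pselect (A x); last first.
        by right; left => z; rewrite inE => /eqP ->.
      have [Ab|nAb] := pselect (A b); first by left.
      by right; right => z; rewrite inE => /eqP ->.
    apply/seteqP; split=> // A [[Ax Ab]] [h|h].
      by apply: (h x); rewrite ?inE.
    by apply: (h b); rewrite ?inE.
  have split2 := mD (void [:: x]) (void [:: b]).
  have split3 := mID (void [:: x]) (void [:: b]).
  have voidI : void [:: b] `&` void [:: x] = void [:: x; b].
    apply/seteqP; split=> A /=.
      by move=> [hb hx] z; rewrite !inE => /orP[/eqP ->|/eqP ->];
        [apply: hx|apply: hb]; rewrite inE.
    by move=> h; split=> z zz; apply: h; rewrite !inE in zz *; rewrite zz ?orbT.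
  rewrite voidI in split3.
  have e1 z : m (void [:: z]) <= expR (- (u * c)).
    rewrite mvoid cap1 ler_expR lerN2 ler_wpM2l ?(ltW u0) //.
    apply: le_trans (cesc z) _; rewrite ler_peMl ?ler1n //.
    exact: le_trans (ltW c0) (cesc z).
  have e2 : m (void [:: x]) * m (void [:: b]) <= m (void [:: x; b]).
    rewrite !mvoid -expRD ler_expR -opprD -mulrDr lerN2 ler_wpM2l ?(ltW u0) //.
    exact: cap2_le.
  have hx := m0 (void [:: x]); have hb := m0 (void [:: b]).
  have ex := e1 x; have eb := e1 b.
  have -> : m both = 1 - m (void [:: x]) - m (void [:: b]) + m (void [:: x; b]) by lra.
  apply: (@le_trans _ _ ((1 - m (void [:: x])) * (1 - m (void [:: b])))); last by nra.
  have e1' : expR (- (u * c)) <= 1 by rewrite -expR0 ler_expR oppr_le0 mulr_ge0 ?ltW.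
  by rewrite /d expr2 ler_pM ?subr_ge0 ?lerD2l ?lerN2.
have mux : mu both = (m both)%:E.
  apply: (hmu [:: x; b]) => A B AB [Ax Ab].
  by split; apply/AB => //; rewrite !inE eqxx ?orbT.
pose W k : set (config V) := connected_within idx k x b.
have mW k : measurable (W k).
  exact: (measurable_depends_on (@connected_within_depends_on v idx k x b idxK)).
pose B := 2 * u * D%:R * (D%:R * ((s * r) ^+ n / (1 - s * r))).
have WB k : (mu (W k) <= B%:E)%E.
  rewrite /W (hmu _ _ (@connected_within_depends_on v idx k x b idxK)) lee_fin.
  apply: le_trans (m_le _ _ (@connected_withinW idx k x b)) _.
  apply: mconn => N; rewrite /B ler_wpM2l ?mulr_ge0 ?ler0n ?(ltW u0) //.
  apply: gen_fun_le => //; try exact: ltW.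
  by move=> j; exact: pstep_le_expr rho0 rhor.
(* Continuity from below, available for [mu] by countable additivity. *)
have UB : (mu (\bigcup_k W k) <= B%:E)%E.
  have mUW : measurable (\bigcup_k W k) by exact: bigcupT_measurable.
  have cW : mu (W k) @[k --> \oo] --> mu (\bigcup_k W k).
    apply: nondecreasing_cvg_mu => // i j ij.
    by apply/subsetPset; exact: (@connected_within_le idx x b).
  rewrite -(cvg_lim _ cW) //; apply: lime_le; first exact: cvgP cW.
  exact: nearW.
have mC := measurable_connected idxK.
have : (mu both <= mu (\bigcup_k W k) + mu (~` [set A | induced_connected nbr A]))%E.
  apply: le_trans (measureU2 mu _ _); first last.
  - exact: measurableC.
  - by apply: bigcupT_measurable.
  apply: le_measure; rewrite ?inE.
  - by apply: (@measurable_depends_on _ [:: x; b]) => A B' AB [Ax Ab];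
      split; apply/AB => //; rewrite !inE eqxx ?orbT.
  - by apply: measurableU; [exact: bigcupT_measurable|exact: measurableC].
  - move=> A [Ax Ab]; have [AC|nAC] := pselect (induced_connected nbr A).
      by left; apply: connected_in_bigcup; split => //; exact: AC.
    by right.
rewrite probability_setC // muC subee // adde0 mux => /le_trans/(_ UB).
rewrite lee_fin => /(le_trans both_ge).
by rewrite leNgt -/d; apply/negP/negPn; apply: le_lt_trans hn; rewrite /B; lra.
Qed.

End Main.

Theorem theorem6p3 (R : realType) (V : eqType) (nbr : V -> seq V) (D : nat) :
  simple_graph nbr -> infinite_graph V -> connected_graph nbr ->
  degree_bounded nbr D ->
  nonamenable nbr R ->
  unif_escape nbr R ->
  forall x y : V,
    ((((2 * D ^ 2)%:R)^-1 * ((spectral_radius nbr R x y)^-1 - 1))%:E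
      <= u_crit nbr R)%E.
Proof.
move=> sg ig cg degD _ esc x y.
apply: le_ereal_inf_tmp => _ [u [u0 hu] <-]; rewrite lee_fin leNgt.
apply/negP => ub.
have D0 : 0 < D%:R :> R by rewrite ltr0n (leq_trans (deg_gt0 ig cg x) (degD x)).
set rho := spectral_radius nbr R x y in ub.
have K0 : 0 < 2 * D%:R ^+ 2 :> R by rewrite mulr_gt0 // exprn_gt0.
rewrite natrM natrX mulrC ltr_pdivlMr // ltrBrDr in ub.
(* Since [0^-1 = 0], this also shows that [rho] is not zero. *)
have ri1 : 1 < rho^-1 by apply: lt_trans ub; rewrite ltrDr mulr_gt0.
have rho0 : 0 < rho by rewrite -invr_gt0 (lt_trans ltr01).
have srho : (1 + 2 * u * D%:R ^+ 2) * rho < 1.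
  by rewrite -ltr_pdivlMr // div1r; apply: le_lt_trans ub; lra.
have [mu lmu] := not_ae_connected sg ig cg degD esc u0 rho0 srho.
by rewrite hu ?eqxx.
Qed.
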